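(* Let $T$ be a tree and let $1 \leq p < \infty$. The forward shift $S$ is bounded on $\mathbb{H}^p_0(T)$ if and only if the set $$\left\{ \frac{K(1,n-1)\, \gamma(n-1)}{\gamma(n)} \, : \, n \in \mathbb{N} \right\}$$ is bounded. In this case, $$\| S \| = \left( \sup \left\{ \frac{K(1,n-1)\, \gamma(n-1)}{\gamma(n)} \, : \, n \in \mathbb{N} \right\} \right)^{1/p}.$$
   Context: $\mathbb{N}=\{1,2,\dots\}$, $\mathbb{N}_0=\{0,1,2,\dots\}$. A tree $T$ means a connected graph with no cycles, with countably infinitely many vertices, locally finite (every vertex has finitely many adjacent vertices), with a distinguished vertex $\mathrm{o}$ called the root. For a vertex $v$, $|v|$ is the number of edges in the unique path between $\mathrm{o}$ and $v$; $v$ is in level $n$ if $|v|=n$, and $\gamma(n)$ is the number of vertices in level $n$. For $v\neq \mathrm{o}$, $\operatorname{par}(v)$ (the parent of $v$) is the unique vertex $w$ on the path from $v$ to $\mathrm{o}$ with $|w|=|v|-1$; the children of $v$ are the vertices $u$ with $\operatorname{par}(u)=v$ (vertices may have no children). $\gamma(1,v)$ is the number of children of $v$, and for $r\in\mathbb{N}_0$, $K(1,r):=\max\{\gamma(1,v): |v|=r\}$. $\mathcal{F}$ is the vector space of all complex-valued functions on the set of vertices of $T$. For $f\in\mathcal{F}$ and $n\in\mathbb{N}_0$, $M_p(n,f):=\left(\frac{1}{\gamma(n)}\sum_{|v|=n}|f(v)|^p\right)^{1/p}$. The little Hardy space $\mathbb{H}^p_0(T)$ is the set of $f\in\mathcal{F}$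 with $\lim_{n\to\infty}M_p(n,f)=0$; it is a Banach space with the norm $\|f\|:=\sup_{n\in\mathbb{N}_0}M_p(n,f)$. The forward shift $S:\mathcal{F}\to\mathcal{F}$ is the linear map $(Sf)(v)=f(\operatorname{par}(v))$ if $v\neq \mathrm{o}$ and $(Sf)(\mathrm{o})=0$. ''$S$ is bounded on $\mathbb{H}^p_0(T)$'' means that $S$ maps $\mathbb{H}^p_0(T)$ into itself and is a bounded linear operator there; $\|S\|$ is then its operator norm. *)

(* Defs.v *)
From HB Require Import structures.
From mathcomp Require Import all_boot all_order all_algebra finmap.
From mathcomp Require Import all_classical all_reals all_analysis.
From mathcomp.real_closed Require Import complex.
Set Implicit Arguments.
Unset Strict Implicit.
Unset Printing Implicit Defensive.
Import Order.TTheory GRing.Theory Num.Theory.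
Import numFieldNormedType.Exports.
Local Open Scope classical_set_scope.
Local Open Scope ring_scope.

(* In [tree_acyclic], a two-vertex sequence [:: x; y] with [x], [y] adjacent is
   a [ucycle] that merely traverses an edge back and forth, hence [2 < size c]. *)
Record tree := Tree {
  vertex :> choiceType;
  tree_adj : rel vertex;
  tree_root : vertex;
  tree_adj_sym : symmetric tree_adj;
  tree_adj_irr : irreflexive tree_adj;
  tree_connected : forall u v : vertex,
    exists s : seq vertex, path tree_adj u s /\ last u s = v;
  tree_acyclic : forall c : seq vertex, (2 < size c)%N -> ~ ucycle tree_adj c;
  tree_locally_finite : forall v : vertex, finite_set [set w | tree_adj v w];
  tree_countably_infinite : ([set: vertex] #= [set: nat])%card }.

Section TreeCombinatorics.
Variable T : tree.

(* A path is written as its starting vertex followed by the sequence of the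
   remaining ones, so [size s] is the number of edges of [tree_root T :: s]. *)
Definition is_root_path (v : T) (s : seq T) : Prop :=
  [/\ path (@tree_adj T) (tree_root T) s,
      last (tree_root T) s = v
    & uniq (tree_root T :: s)].

Definition root_path (v : T) : seq T := xget [::] [set s | is_root_path v s].

Definition depth (v : T) : nat := size (root_path v).

(* [par (tree_root T)] is a junk value. *)
Definition par (v : T) : T :=
  xget (tree_root T)
    [set w | w \in tree_root T :: root_path v /\ (depth w).+1 = depth v].

Definition children (v : T) : set T := [set u | u <> tree_root T /\ par u = v].

Definition level (n : nat) : set T := [set v | depth v = n].

(* Children sets and levels are finite by local finiteness, so that [fset_set]
   enumerates them faithfully. *)
Definition nb_children (v : T) : nat := #|` fset_set (children v)|.

Definition level_size (n : nat) : nat := #|` fset_set (level n)|.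

(* Levels are nonempty: this is a genuine maximum. *)
Definition max_children (r : nat) : nat :=
  (\max_(v <- fset_set (level r)) nb_children v)%N.

End TreeCombinatorics.

Section HardySpace.
Variables (R : realType) (T : tree).
Local Notation F := (T -> R[i]).

(* [normc] is the complex modulus, valued in [R]. *)
Definition pmean (p : R) (n : nat) (f : F) : R :=
  ((level_size T n)%:R^-1 *
    \sum_(v \in @level T n) (ComplexField.Normc.normc (f v) `^ p)) `^ p^-1.

Definition little_hardy (p : R) : set F :=
  [set f | pmean p n f @[n --> \oo] --> (0 : R)].

Definition hardy_norm (p : R) (f : F) : R :=
  sup [set pmean p n f | n in [set: nat]].

Definition bounded_on_little_hardy (p : R) (A : {linear F -> F}) : Prop :=
  (forall f, little_hardy p f -> little_hardy p (A f)) /\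
  exists C : R, forall f, little_hardy p f ->
    hardy_norm p (A f) <= C * hardy_norm p f.

Definition little_hardy_opnorm (p : R) (A : {linear F -> F}) : R :=
  sup [set hardy_norm p (A f) | f in
         [set f | little_hardy p f /\ hardy_norm p f <= 1]].

Definition forward_shift (f : F) : F :=
  fun v => if v == tree_root T then 0 else f (par v).

Lemma forward_shift_is_linear : linear forward_shift.
Proof.
move=> a f g; apply/funext => v; rewrite /forward_shift.
change ((if v == tree_root T then 0 else a *: f (par v) + g (par v)) =
  a *: (if v == tree_root T then 0 else f (par v)) +
  (if v == tree_root T then 0 else g (par v))).
by case: ifP => // _; rewrite scaler0 addr0.
Qed.

HB.instance Definition _ :=
  GRing.isLinear.Build R[i] F F _ forward_shift forward_shift_is_linear.

End HardySpace.

Definition shift_ratios (R : realType) (T : tree) : set R :=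
  [set (max_children T n.-1 * level_size T n.-1)%:R / (level_size T n)%:R
    | n in [set n : nat | (0 < n)%N]].
Arguments shift_ratios : clear implicits.

(* Main.v *)
Require Import Defs.
From mathcomp Require Import all_boot all_order all_algebra finmap.
From mathcomp Require Import all_classical all_reals all_analysis.
From mathcomp.real_closed Require Import complex.
From mathcomp Require Import ring.
Import Order.TTheory GRing.Theory Num.Theory.
Import numFieldNormedType.Exports.
Local Open Scope classical_set_scope.
Local Open Scope ring_scope.

(** Write [g n] for the size of level [n] and [K n] for the maximal number of
    children of a vertex of level [n].  Every vertex of level [n + 1] has its
    parent in level [n], so grouping by parents gives
    [\sum_(|v| = n + 1) |S f v|^p = \sum_(|w| = n) (number of children of w) * |f w|^p],
    and bounding the number of children by [K n] yields
    [M_p (n + 1, S f) <= (K n * g n / g (n + 1))^(1/p) * M_p (n, f)]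
    ([pmean_shiftS_le]).  If the ratios [K n * g n / g (n + 1)] are bounded by
    [r], this shows that [S] preserves the little Hardy space and has norm at
    most [r^(1/p)] ([shift_bound]).

    Conversely, let [w] be a vertex of level [n] with [K n] children.  The
    multiple [g n^(1/p)] of the indicator function of [w] has Hardy norm at most
    1, and its image under [S] has mean exactly [(K n * g n / g (n + 1))^(1/p)]
    over level [n + 1] ([pmean_shift_unit_bump]).  Hence any bound for [S] bounds
    all the ratios, and their supremum is at most the [p]-th power of the norm of
    [S] ([shift_opnormE]).

    The remaining work is about trees.  Root paths are unique by acyclicity
    ([uniq_path_inj]); hence the depth grows by exactly one from a parent to its
    child ([depth_par]).  It follows that levels are finite, by local finiteness,
    and nonempty, since otherwise the tree would be finite. *)

Set Implicit Arguments.
Unset Strict Implicit.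
Unset Printing Implicit Defensive.

(** * Root paths, levels and children *)

Lemma bigmaxn_attained (I : eqType) (s : seq I) (F : I -> nat) (i : I) :
  i \in s -> exists2 j, j \in s & F j = (\max_(k <- s) F k)%N.
Proof.
elim: s i => // j s IHs i _; rewrite big_cons.
case: (leqP (F j) (\max_(k <- s) F k)) => leF; last first.
  by exists j; rewrite ?inE ?eqxx.
case: s IHs leF => [|k s] IHs leF.
  by exists j; [rewrite inE|move: leF; rewrite big_nil leqn0 => /eqP].
have [|l ls lE] := IHs k; first by rewrite inE eqxx.
by exists l; rewrite // inE ls orbT.
Qed.

Section TreeLevels.
Variable T : tree.

(** Two distinct neighbours [a], [b] of [x] joined by a walk avoiding [x] would
    close up through [x] to a cycle. *)
Lemma acyclic_nbrs_eq (x a b : T) (s : seq T) :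
  tree_adj x a -> tree_adj x b -> path (@tree_adj T) a s -> last a s = b ->
  x \notin a :: s -> a = b.
Proof.
move=> xa xb; case/shortenP=> s' ps' us' sub lastb xNs.
case: s' => [|y s'] in ps' us' sub lastb; first by [].
case: (@tree_acyclic T (x :: a :: y :: s')) => //.
rewrite /ucycle /cycle rcons_path -[last x _]/(last a (y :: s')) lastb.
rewrite (tree_adj_sym b) xb andbT; apply/andP; split; first by apply/andP.
rewrite cons_uniq us' andbT; apply: contra xNs.
by rewrite !inE => /or3P[->//|xy|xs]; rewrite sub ?orbT// inE ?xy ?xs ?orbT.
Qed.

(** In a tree, a simple path is determined by its endpoints: if two of them left
    [x] through different neighbours, then following the first one to the common
    endpoint and the second one backwards would join these neighbours away from
    [x]. *)
Lemma uniq_path_inj (x : T) (s t : seq T) :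
  path (@tree_adj T) x s -> path (@tree_adj T) x t ->
  uniq (x :: s) -> uniq (x :: t) -> last x s = last x t -> s = t.
Proof.
elim: s x t => [|a s IHs] x [|b t] //=.
- by move=> _ _ _ /andP[xNt _] xE; rewrite xE mem_last in xNt.
- by move=> _ _ /andP[xNs _] _ xE; rewrite -xE mem_last in xNs.
move=> /andP[xa ps] /andP[xb pt] /andP[xNs us] /andP[xNt ut] lastE.
suff eab : a = b by rewrite -eab in pt ut lastE *; rewrite (IHs a t).
apply: (@acyclic_nbrs_eq x a b (s ++ rev (belast b t))) => //.
- rewrite cat_path ps lastE rev_path.
  by rewrite (eq_path (e' := @tree_adj T)) // => u v; rewrite tree_adj_sym.
- rewrite last_cat lastE; case: t {IHs pt xNt ut lastE} => [//|c t] /=.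
  by rewrite rev_cons last_rcons.
rewrite -cat_cons mem_cat (negPf xNs) mem_rev /=.
by apply: contra xNt => /mem_belast.
Qed.

Lemma root_pathP (v : T) : is_root_path v (root_path v).
Proof.
apply: xgetPex; have [s [ps lasts]] := tree_connected (tree_root T) v.
by move: lasts; case/shortenP: ps => s' ps' us' _ lasts; exists s'.
Qed.

Lemma root_path_unique (v : T) s : is_root_path v s -> root_path v = s.
Proof.
move=> [ps lasts us]; have [pr lastr ur] := root_pathP v.
by apply: (@uniq_path_inj (tree_root T)) => //; rewrite lastr lasts.
Qed.

Lemma root_path_root : root_path (tree_root T) = [::].
Proof. exact: root_path_unique. Qed.

Lemma depth_eq0 (v : T) : depth v = 0%N -> v = tree_root T.
Proof. by move=> /size0nil r0; have [_ <- _] := root_pathP v; rewrite r0. Qed.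

Lemma depth_root : depth (tree_root T) = 0%N.
Proof. by rewrite /depth root_path_root. Qed.

(** The witness [w] is the penultimate vertex of the root path of [v]. *)
Lemma root_path_penultimate (v : T) : v != tree_root T ->
  exists w, [/\ tree_adj w v, depth v = (depth w).+1
              & w \in tree_root T :: root_path v].
Proof.
move=> vr; have [] := root_pathP v.
move rE: (root_path v) => r; case: (lastP r) rE => [_ _ /esym/eqP|s u rE].
  by rewrite (negPf vr).
rewrite rcons_path last_rcons => /andP[ps adju] uv.
rewrite -rcons_cons rcons_uniq => /andP[_ us]; rewrite -uv.
exists (last (tree_root T) s); split=> //.
  rewrite uv /depth rE size_rcons; congr _.+1.
  by rewrite (@root_path_unique (last (tree_root T) s) s).
by rewrite mem_rcons inE mem_last orbT.
Qed.

Lemma depth_par (v : T) : v != tree_root T -> depth v = (depth (par v)).+1.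
Proof.
move=> /root_path_penultimate[w [_ dv wv]]; rewrite /par.
by have [//|] := @xgetPex _ (tree_root T)
  [set w | w \in tree_root T :: root_path v /\ (depth w).+1 = depth v];
  first by exists w.
Qed.

Lemma finite_level n : finite_set (@level T n).
Proof.
elim: n => [|n IHn].
  by apply: (@sub_finite_set _ _ [set tree_root T]) => // v /depth_eq0.
apply: (@sub_finite_set _ _ (\bigcup_(w in @level T n) [set v | tree_adj w v])).
  move=> v /= dv; have [|w [wv dvw _]] := @root_path_penultimate v.
    by apply/eqP => vr; move: dv; rewrite /level/= vr depth_root.
  by exists w => //=; rewrite /level/=; move: dv; rewrite /level/= dvw => -[].
by apply: bigcup_finite => // w _; exact: tree_locally_finite.
Qed.

Lemma level_nonempty n : exists v : T, depth v = n.
Proof.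
apply: contrapT => nlev; apply: infinite_nat.
rewrite -(eq_finite_set (tree_countably_infinite T)).
(* Going up [m] times to the parent from level [m + n] leads to level [n]. *)
have noge m (v : T) : depth v <> (m + n)%N.
  elim: m v => [v dv|m IHm v dv]; first by apply: nlev; exists v.
  have [vr|vr] := eqVneq v (tree_root T).
    by move: dv; rewrite vr depth_root.
  by apply: (IHm (par v)); move: dv; rewrite depth_par // addSn => -[].
apply: (@sub_finite_set _ _ (\bigcup_(k in `I_n) @level T k)).
  move=> v _ /=; exists (depth v) => //=; rewrite ltnNge; apply/negP => le_n.
  by apply: (noge (depth v - n)%N v); rewrite subnK.
by apply: bigcup_finite => // k _; exact: finite_level.
Qed.

Lemma level_size_gt0 n : (0 < level_size T n)%N.
Proof.
have [v dv] := level_nonempty n; rewrite /level_size cardfs_gt0.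
by apply/fset0Pn; exists v; rewrite in_fset_set ?inE //; exact: finite_level.
Qed.

Lemma mem_level n (v : T) : (v \in fset_set (@level T n)) = (depth v == n).
Proof.
rewrite in_fset_set; last exact: finite_level.
by apply/idP/eqP; rewrite inE.
Qed.

(** The children of [w] all lie in the next level, so that they can be counted
    there. *)
Lemma nb_childrenE (w : T) :
  nb_children w =
  count (fun v => par v == w) (fset_set (@level T (depth w).+1)).
Proof.
have sub : children w `<=` @level T (depth w).+1.
  by move=> v [/eqP vr <-]; rewrite /level /= depth_par.
rewrite -size_filter; apply/perm_size/uniq_perm.
- exact: fset_uniq.
- by rewrite filter_uniq // fset_uniq.
move=> v; rewrite mem_filter mem_level in_fset_set; last first.
  exact: sub_finite_set sub (finite_level _).
apply/idP/andP; rewrite inE.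
  by move=> cv; split; [case: cv => _ /eqP|apply/eqP; exact: sub].
move=> [/eqP pv /eqP dv]; split=> // vr.
by move: dv; rewrite vr depth_root.
Qed.

(** Regrouping a sum over level [n + 1] by parents. *)
Lemma sum_level_par (R : nmodType) n (G : T -> R) :
  \sum_(v <- fset_set (@level T n.+1)) G (par v) =
  \sum_(w <- fset_set (@level T n)) G w *+ nb_children w.
Proof.
(* Expand [G (par v)] as a sum over the [w] of level [n] equal to [par v], then
   exchange the two sums. *)
transitivity (\sum_(v <- fset_set (@level T n.+1))
    \sum_(w <- fset_set (@level T n) | w == par v) G w).
  rewrite big_seq [RHS]big_seq; apply: eq_bigr => v.
  rewrite mem_level => /eqP dv.
  rewrite -big_filter (_ : [seq _ <- _ | _] = [:: par v]) ?big_seq1 //.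
  rewrite filter_pred1_uniq ?fset_uniq // mem_level -eqSS -depth_par ?dv //.
  by apply/eqP => vr; rewrite vr depth_root in dv.
rewrite (exchange_big_dep predT) //= big_seq [RHS]big_seq.
apply: eq_bigr => w; rewrite mem_level => /eqP dw.
rewrite big_const_seq iter_addr_0 nb_childrenE dw.
by congr (_ *+ _); apply: eq_count => v; rewrite eq_sym.
Qed.

Lemma nb_children_le_max (w : T) : (nb_children w <= max_children T (depth w))%N.
Proof. by apply: leq_bigmax_seq => //; rewrite mem_level. Qed.

Lemma max_childrenP n :
  exists2 w : T, depth w = n & nb_children w = max_children T n.
Proof.
have [v dv] := level_nonempty n.
have [|w] := @bigmaxn_attained _ (fset_set (@level T n)) (@nb_children T) v.
  by rewrite mem_level dv.
by rewrite mem_level => /eqP dw we; exists w.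
Qed.

End TreeLevels.
(** * Means of shifted functions *)

Section ShiftBounds.
Variables (R : realType) (T : tree) (p : R).
Hypothesis p_ge1 : 1 <= p.
Local Notation F := (T -> R[i]).
Local Notation normc := ComplexField.Normc.normc.
Local Notation S := (@forward_shift R T).

Let p_gt0 : 0 < p. Proof. exact: lt_le_trans p_ge1. Qed.
Let p_neq0 : p != 0. Proof. by rewrite gt_eqF. Qed.
Let pV_ge0 : 0 <= p^-1. Proof. by rewrite invr_ge0 ltW. Qed.

Let powRpV (x : R) : 0 <= x -> (x `^ p^-1) `^ p = x.
Proof. by move=> x0; rewrite -powRrM mulVf // powRr1. Qed.

Let powRVp (x : R) : 0 <= x -> (x `^ p) `^ p^-1 = x.
Proof. by move=> x0; rewrite -powRrM divff // powRr1. Qed.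

Let ler_powRV (x y : R) : 0 <= x -> x <= y -> x `^ p^-1 <= y `^ p^-1.
Proof.
by move=> x0 xy; apply: ge0_ler_powR => //; rewrite nnegrE // (le_trans x0).
Qed.

Let level_size_gt0R n : 0 < (level_size T n)%:R :> R.
Proof. by rewrite ltr0n level_size_gt0. Qed.

(** The sum of the [p]-th powers of the moduli over a level: [pmean] without
    normalization and root. *)
Definition level_sum (n : nat) (f : F) : R :=
  \sum_(v <- fset_set (@level T n)) normc (f v) `^ p.

Lemma level_sum_ge0 n f : 0 <= level_sum n f.
Proof. by apply: sumr_ge0 => v _; exact: powR_ge0. Qed.

Lemma pmeanE n (f : F) :
  pmean p n f = ((level_size T n)%:R^-1 * level_sum n f) `^ p^-1.
Proof. by rewrite /pmean fsbig_finite//; exact: finite_level. Qed.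

Lemma level_sum_shift n f :
  level_sum n.+1 (S f) =
  \sum_(w <- fset_set (@level T n)) normc (f w) `^ p *+ nb_children w.
Proof.
rewrite -(sum_level_par n (fun w => normc (f w) `^ p)).
rewrite /level_sum big_seq [RHS]big_seq; apply: eq_bigr => v.
rewrite mem_level /forward_shift => /eqP dv; case: eqP => // vr.
by rewrite vr depth_root in dv.
Qed.

(** The element of [shift_ratios] of index [n + 1]; this indexing by the upper of
    the two levels avoids the predecessor. *)
Definition shift_ratio (n : nat) : R :=
  (max_children T n * level_size T n)%:R / (level_size T n.+1)%:R.

Lemma shift_ratio_ge0 n : 0 <= shift_ratio n.
Proof. by rewrite divr_ge0. Qed.

Lemma shift_ratiosE : shift_ratios R T = range shift_ratio.
Proof.
apply/seteqP; split=> x [n /= n0 <-]; first by exists n.-1; case: n n0.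
by exists n.+1.
Qed.

Lemma pmean_shiftS_le n f :
  pmean p n.+1 (S f) <= shift_ratio n `^ p^-1 * pmean p n f.
Proof.
rewrite !pmeanE -powRM ?shift_ratio_ge0 ?mulr_ge0 ?invr_ge0 ?level_sum_ge0 //.
apply: ler_powRV; first by rewrite mulr_ge0 ?invr_ge0 ?level_sum_ge0.
have -> : shift_ratio n * ((level_size T n)%:R^-1 * level_sum n f) =
    (level_size T n.+1)%:R^-1 * ((max_children T n)%:R * level_sum n f).
  by rewrite /shift_ratio natrM; field; rewrite !gt_eqF.
rewrite ler_wpM2l ?invr_ge0 // level_sum_shift /level_sum mulr_sumr.
rewrite big_seq [leRHS]big_seq; apply: ler_sum => w; rewrite mem_level => /eqP dw.
by rewrite -[leLHS]mulr_natl ler_wpM2r ?powR_ge0 // ler_nat -dw nb_children_le_max.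
Qed.

Lemma pmean_shift0 f : pmean p 0 (S f) = 0.
Proof.
rewrite pmeanE /level_sum big_seq big1 ?mulr0 ?powR0 ?invr_neq0 // => v.
rewrite mem_level => /eqP /depth_eq0 ->.
by rewrite /forward_shift eqxx ComplexField.Normc.normc0 powR0.
Qed.

Lemma pmean_ge0 n (f : F) : 0 <= pmean p n f.
Proof. exact: powR_ge0. Qed.

Lemma pmean_le_hardy_norm (f : F) n :
  little_hardy p f -> pmean p n f <= hardy_norm p f.
Proof.
move=> hf; apply: ub_le_sup; last by exists n.
have /cvg_has_ub[M hM] : cvgn (fun n => pmean p n f) by apply: cvgP hf.
exists M => _ [k _ <-]; apply: le_trans (ler_norm _) _.
by apply: hM; exists k.
Qed.

Lemma hardy_norm_le (f : F) c :
  (forall n, pmean p n f <= c) -> hardy_norm p f <= c.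
Proof.
move=> hc; apply: ge_sup; first by exists (pmean p 0 f), 0%N.
by move=> _ [n _ <-].
Qed.

Lemma hardy_norm_ge0 (f : F) : little_hardy p f -> 0 <= hardy_norm p f.
Proof. by move=> /(pmean_le_hardy_norm 0); apply: le_trans; exact: pmean_ge0. Qed.

(** * Boundedness and norm of the shift *)

(** The upper bound: [r^(1/p)] bounds the shift as soon as [r] bounds all the
    ratios. *)
Lemma shift_bound (r : R) : (forall n, shift_ratio n <= r) ->
  forall f, little_hardy p f ->
    little_hardy p (S f) /\ hardy_norm p (S f) <= r `^ p^-1 * hardy_norm p f.
Proof.
move=> hr f hf.
have le_mean n : pmean p n.+1 (S f) <= r `^ p^-1 * pmean p n f.
  apply: le_trans (pmean_shiftS_le n f) _; rewrite ler_wpM2r ?pmean_ge0 //.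
  by apply: ler_powRV => //; exact: shift_ratio_ge0.
split.
  rewrite /little_hardy /= -cvg_shiftS.
  apply: (@squeeze_cvgr _ _ _ _ (fun=> 0) (fun n => r `^ p^-1 * pmean p n f)).
  - by near=> n; rewrite pmean_ge0 le_mean.
  - exact: cvg_cst.
  - by rewrite -[X in _ --> X](mulr0 (r `^ p^-1)); apply: cvgMl_tmp.
apply: hardy_norm_le => -[|n].
  by rewrite pmean_shift0 mulr_ge0 ?powR_ge0 ?hardy_norm_ge0.
apply: le_trans (le_mean n) _.
by rewrite ler_wpM2l ?powR_ge0 ?pmean_le_hardy_norm.
Unshelve. all: by end_near. Qed.

(** The function supported at [w], normalized so that its mean over the level of
    [w] is 1. *)
Definition unit_bump (w : T) : F := fun v =>
  if v == w then (((level_size T (depth w))%:R `^ p^-1)%:C)%C else 0.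

Lemma normc_unit_bump w v :
  normc (unit_bump w v) `^ p =
  if v == w then (level_size T (depth w))%:R else 0.
Proof.
rewrite /unit_bump; case: eqP => _; last first.
  by rewrite ComplexField.Normc.normc0 powR0.
by rewrite /= expr0n /= addr0 sqrtr_sqr ger0_norm ?powR_ge0 ?powRpV.
Qed.

(** The weights [c] cover both the mean of [unit_bump w] (with [c] constant
    equal to 1) and that of its shift (with [c] the number of children). *)
Lemma sum_level_unit_bump w n (c : T -> nat) :
  \sum_(v <- fset_set (@level T n)) normc (unit_bump w v) `^ p *+ c v =
  if n == depth w then (level_size T n)%:R *+ c w else 0.
Proof.
under eq_bigr do rewrite normc_unit_bump (fun_if (fun x => x *+ _)) mul0rn.
rewrite -big_mkcond /=.
case: eqP => [->|/eqP nw].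
  rewrite -big_filter filter_pred1_uniq ?fset_uniq ?big_seq1 //.
  by rewrite mem_level.
rewrite big_seq_cond big1 // => v /andP[]; rewrite mem_level => /eqP dv /eqP vw.
by rewrite -dv vw eqxx in nw.
Qed.

Lemma pmean_unit_bump w n : pmean p n (unit_bump w) = (n == depth w)%:R.
Proof.
rewrite pmeanE /level_sum.
have -> : \sum_(v <- fset_set (@level T n)) normc (unit_bump w v) `^ p =
    \sum_(v <- fset_set (@level T n)) normc (unit_bump w v) `^ p *+ 1.
  by apply: eq_bigr => v _; rewrite mulr1n.
rewrite (sum_level_unit_bump w n (fun=> 1%N)).
case: eqP => _; last by rewrite mulr0 powR0 // invr_neq0.
by rewrite mulr1n mulVf ?powR1 // gt_eqF.
Qed.

Lemma pmean_shift_unit_bump w : nb_children w = max_children T (depth w) ->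
  pmean p (depth w).+1 (S (unit_bump w)) = shift_ratio (depth w) `^ p^-1.
Proof.
move=> cw; rewrite pmeanE level_sum_shift sum_level_unit_bump eqxx cw.
by rewrite -[_ *+ max_children _ _]mulr_natl -natrM mulrC.
Qed.

Lemma little_hardy_unit_bump w : little_hardy p (unit_bump w).
Proof.
apply: cvg_near_cst; exists (depth w).+1 => // n /= nw.
by rewrite pmean_unit_bump gtn_eqF.
Qed.

Lemma hardy_norm_unit_bump_le1 w : hardy_norm p (unit_bump w) <= 1.
Proof.
by apply: hardy_norm_le => n; rewrite pmean_unit_bump; case: eqP.
Qed.

(** The lower bound, realized by [unit_bump w] for a vertex [w] of level [n] with
    the largest number of children. *)
Lemma shift_ratio_extremal n :
  (forall f, little_hardy p f -> little_hardy p (S f)) ->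
  exists f, [/\ little_hardy p f, hardy_norm p f <= 1
              & shift_ratio n `^ p^-1 <= hardy_norm p (S f)].
Proof.
move=> hS; have [w dw cw] := max_childrenP T n.
exists (unit_bump w); split.
- exact: little_hardy_unit_bump.
- exact: hardy_norm_unit_bump_le1.
rewrite -dw -pmean_shift_unit_bump ?dw //.
apply/pmean_le_hardy_norm/hS/little_hardy_unit_bump.
Qed.

Lemma shift_ratio_le_powR n (c : R) :
  shift_ratio n `^ p^-1 <= c -> shift_ratio n <= c `^ p.
Proof.
move=> rc; rewrite -(powRpV (shift_ratio_ge0 n)).
apply: ge0_ler_powR => //; first exact: ltW.
- by rewrite nnegrE powR_ge0.
- by rewrite nnegrE (le_trans _ rc) ?powR_ge0.
Qed.

Lemma bounded_shift_ratiosP :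
  bounded_set (shift_ratios R T) <-> exists r, forall n, shift_ratio n <= r.
Proof.
rewrite shift_ratiosE; split.
  move=> /pinfty_ex_gt0[M _ hM]; exists M => n.
  by apply: le_trans (ler_norm _) _; apply: hM; exists n.
move=> [r hr]; exists r; split; first exact: num_real.
move=> M rM _ [n _ <-] /=; rewrite ger0_norm ?shift_ratio_ge0 //.
exact: le_trans (hr n) (ltW rM).
Qed.

Lemma shift_bounded_iff : bounded_on_little_hardy p S <->
  exists r, forall n, shift_ratio n <= r.
Proof.
split=> [[hS [C hC]]|[r hr]].
  (* Nothing is known about the sign of [C]. *)
  exists ((Num.max C 0) `^ p) => n; apply: shift_ratio_le_powR.
  have [f [hf f1 /le_trans]] := shift_ratio_extremal n hS; apply.
  apply: le_trans (hC f hf) _.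
  apply: (@le_trans _ _ (Num.max C 0 * hardy_norm p f)).
    by rewrite ler_wpM2r ?hardy_norm_ge0 // le_max lexx.
  by rewrite ler_piMr // le_max lexx orbT.
split=> [f hf|]; first exact: (shift_bound hr hf).1.
by exists (r `^ p^-1) => f hf; exact: (shift_bound hr hf).2.
Qed.

Lemma shift_opnormE (r : R) : (forall n, shift_ratio n <= r) ->
  little_hardy_opnorm p S = sup (shift_ratios R T) `^ p^-1.
Proof.
rewrite shift_ratiosE => hr; set s := sup _.
have ub_s n : shift_ratio n <= s.
  by apply: ub_le_sup; [exists r => _ [k _ <-]|exists n].
have s_ge0 : 0 <= s by apply: le_trans (ub_s 0%N); exact: shift_ratio_ge0.
have hS f : little_hardy p f -> little_hardy p (S f).
  by move=> hf; exact: (shift_bound ub_s hf).1.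
have ub_op : ubound [set hardy_norm p (S f) | f in
    [set f | little_hardy p f /\ hardy_norm p f <= 1]] (s `^ p^-1).
  move=> _ [f [hf f1] <-]; apply: le_trans (shift_bound ub_s hf).2 _.
  by rewrite ler_piMr ?powR_ge0.
have le_op n : shift_ratio n `^ p^-1 <= little_hardy_opnorm p S.
  have [f [hf f1 /le_trans]] := shift_ratio_extremal n hS; apply.
  by apply: ub_le_sup; [exists (s `^ p^-1)|exists f].
have op_ge0 : 0 <= little_hardy_opnorm p S.
  by apply: le_trans (le_op 0%N); exact: powR_ge0.
apply/eqP; rewrite eq_le; apply/andP; split.
  apply: ge_sup => //; have [f [hf f1 _]] := shift_ratio_extremal 0 hS.
  by exists (hardy_norm p (S f)), f.
rewrite -(powRVp op_ge0); apply: ler_powRV => //.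
apply: ge_sup; first by exists (shift_ratio 0), 0%N.
by move=> _ [n _ <-]; exact: shift_ratio_le_powR.
Qed.

End ShiftBounds.

Theorem theorem3p1p2 (T : tree) (R : realType) (p : R) (hp : 1 <= p) :
  (bounded_on_little_hardy p (@forward_shift R T) <-> bounded_set (shift_ratios R T)) /\
  (bounded_on_little_hardy p (@forward_shift R T) ->
     little_hardy_opnorm p (@forward_shift R T) = sup (shift_ratios R T) `^ p^-1).
Proof.
split; first by rewrite bounded_shift_ratiosP; exact: shift_bounded_iff.
by move=> /(shift_bounded_iff T hp)[r hr]; exact: shift_opnormE hr.
Qed.
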